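(* The metric space $(\widehat{A_\infty}, d)$ is quasi-isometric to the half-line $\mathbb{R}_{+}=[0,\infty)$ (with its usual metric $|x-y|$).
   Context: $S_\infty$ (the infinite symmetric group) is the group of all bijections of $\mathbb{N}=\{1,2,3,\dots\}$ with finite support, and $A_\infty$ (the infinite alternating group) is its subgroup of even permutations; $A_\infty$ is a simple group. For a group $G$ and $g\in G$, let $C_g$ be the conjugacy class of $g$ in $G$ and $[g]:=C_g\cup C_{g^{-1}}$. If $G$ is simple and $g,h\in G$ are nontrivial, then $g$ is a finite product of elements of $[h]$, and $\lambda_h(g)$ denotes the minimum $n$ such that $g=h_1h_2\cdots h_n$ with all $h_i\in[h]$. The number $\lambda_h(g)$ depends only on $[h]$ and $[g]$, and is also written $\lambda_{[h]}([g])$. For a simple group $G$ with identity $e$, let $\widehat{G}:=\{[g] \mid g\in G\setminus\{e\}\}$, and for $[g],[h]\in\widehat{G}$ set $$d([g],[h]):=\log\bigl(\max\{\lambda_{[g]}([h]),\lambda_{[h]}([g])\}\bigr).$$ This $d$ is a metric on $\widehat{G}$. Here $G=A_\infty$. *)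

(* Defs.v *)
From HB Require Import structures.
From mathcomp Require Import all_boot all_order all_algebra.
From mathcomp Require Import all_classical all_reals all_analysis.

Set Implicit Arguments.
Unset Strict Implicit.
Unset Printing Implicit Defensive.

Import Order.TTheory GRing.Theory Num.Theory.

Local Open Scope classical_set_scope.
Local Open Scope group_scope.

Section SymClass.
Variable G : groupType.
Implicit Types (g h k x : G) (N : set G).

Definition conj_class g : set G := [set g ^ x | x in [set: G]].

Definition sym_class g : set G := conj_class g `|` conj_class g^-1.

Definition is_normal_subgroup N :=
  [/\ N 1, forall x y, N x -> N y -> N (x * y), forall x, N x -> N x^-1
    & forall x y, N x -> N (x ^ y)].

Definition is_sym_product h g (n : nat) :=
  exists s : seq G, [/\ size s = n, {in s, forall x, sym_class h x}
                      & g = \prod_(x <- s) x].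

(* The fallback value 0 is never taken when [G] is simple and [h != 1]: see
   [lambdaP]. *)
Definition lambda h g : nat :=
  xget 0%N [set n | is_sym_product h g n /\
                    forall m, is_sym_product h g m -> (n <= m)%N].

Lemma sym_class_refl g : sym_class g g.
Proof. by left; exists 1 => //; rewrite conjg1. Qed.

Lemma sym_classV h g : sym_class h g -> sym_class h g^-1.
Proof.
by case=> -[x _ <-]; [right | left]; exists x; rewrite // conjVg ?invgK.
Qed.

Lemma sym_classJ h g x : sym_class h g -> sym_class h (g ^ x).
Proof.
by case=> -[y _ <-]; [left | right]; exists (y * x); rewrite // conjgM.
Qed.

Lemma sym_class_trans h k g :
  sym_class h k -> sym_class k g -> sym_class h g.
Proof.
by move=> hk; case=> -[x _ <-]; apply: sym_classJ => //; apply: sym_classV.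
Qed.

Lemma sym_class_sym h g : sym_class h g -> sym_class g h.
Proof.
case=> -[x _ <-]; first by left; exists x^-1; rewrite // conjgK.
by right; exists x^-1; rewrite // -conjVg invgK conjgK.
Qed.

Lemma sym_class_eq h g : sym_class h g -> sym_class g = sym_class h.
Proof.
move=> hg; apply/seteqP; split=> x; first exact: sym_class_trans.
by apply: sym_class_trans; apply: sym_class_sym.
Qed.

Lemma is_sym_product0 h : is_sym_product h 1 0.
Proof. by exists [::]; rewrite big_nil. Qed.

Lemma is_sym_product1 h g : is_sym_product h g 1 <-> sym_class h g.
Proof.
split=> [[[|x [|? ?]] [] // _ hs ->]|hg].
  by rewrite big_seq1; apply: hs; rewrite mem_head.
by exists [:: g]; split=> [//|x|]; rewrite ?big_seq1 // inE => /eqP ->.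
Qed.

Lemma is_sym_productM h g k m n : is_sym_product h g m ->
  is_sym_product h k n -> is_sym_product h (g * k) (m + n).
Proof.
move=> [s [<- hs ->]] [t [<- ht ->]]; exists (s ++ t).
split; rewrite ?size_cat ?big_cat // => x.
by rewrite mem_cat => /orP[/hs|/ht].
Qed.

Lemma is_sym_productV h g n : is_sym_product h g n -> is_sym_product h g^-1 n.
Proof.
move=> [s [<- + ->]]; elim: s => [|x s IHs] hs.
  by rewrite big_nil invg1; apply: is_sym_product0.
rewrite big_cons invgM /= -addn1; apply: is_sym_productM.
  by apply: IHs => y ys; apply: hs; rewrite inE ys orbT.
by apply/is_sym_product1/sym_classV/hs; rewrite mem_head.
Qed.

Lemma is_sym_productJ h g x n :
  is_sym_product h g n -> is_sym_product h (g ^ x) n.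
Proof.
move=> [s [<- + ->]]; elim: s => [|y s IHs] hs.
  by rewrite big_nil conj1g; apply: is_sym_product0.
rewrite big_cons conjMg /= -add1n; apply: is_sym_productM.
  by apply/is_sym_product1/sym_classJ/hs; rewrite mem_head.
by apply: IHs => z zs; apply: hs; rewrite inE zs orbT.
Qed.

Lemma is_sym_product_trans h k g m n : is_sym_product h k m ->
  is_sym_product k g n -> is_sym_product h g (m * n).
Proof.
move=> hk [s [<- + ->]]; elim: s => [|x s IHs] ks.
  by rewrite big_nil muln0; apply: is_sym_product0.
rewrite big_cons /= mulnS; apply: is_sym_productM.
  have [] := ks x (mem_head _ _) => -[y _ <-]; first exact: is_sym_productJ.
  exact/is_sym_productJ/is_sym_productV.
by apply: IHs => y ys; apply: ks; rewrite inE ys orbT.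
Qed.

Lemma lambda_class h h' g g' :
    sym_class h = sym_class h' -> sym_class g = sym_class g' ->
  lambda h g = lambda h' g'.
Proof.
move=> hh' gg'; suff E n : is_sym_product h g n <-> is_sym_product h' g' n.
  rewrite /lambda; congr xget; apply/seteqP.
  by split=> n /= [/E hn mn]; split=> // m /E; apply: mn.
have sub a b c : sym_class a = sym_class b ->
    is_sym_product h a n -> is_sym_product h b n.
  move=> ab; have [] : sym_class a b by rewrite ab; apply: sym_class_refl.
    by move=> -[x _ <-]; apply: is_sym_productJ.
  by move=> -[x _ <-] /is_sym_productV; apply: is_sym_productJ.
rewrite /is_sym_product -hh'; split; exact: sub.
Qed.

End SymClass.

HB.mixin Record isSimpleGroup G & Group G := {
  simple_nontrivial : exists g : G, g != 1;
  simple_normal : forall N : set G,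
    is_normal_subgroup N -> N = [set 1] \/ N = [set: G]
}.

#[short(type="simpleGroupType")]
HB.structure Definition SimpleGroup := {G of isSimpleGroup G & Group G}.

Section SimpleLambda.
Variable G : simpleGroupType.
Implicit Types g h k : G.

Lemma sym_product_exists h g : h != 1 -> exists n, is_sym_product h g n.
Proof.
move=> h1; have nN : is_normal_subgroup [set x | exists n, is_sym_product h x n].
  split=> /= [|x y [m ?] [n ?]|x [n ?]|x y [n ?]].
  - by exists 0%N; apply: is_sym_product0.
  - by exists (m + n)%N; apply: is_sym_productM.
  - by exists n; apply: is_sym_productV.
  - by exists n; apply: is_sym_productJ.
have hN : [set x | exists n, is_sym_product h x n] h.
  by exists 1%N; apply/is_sym_product1/sym_class_refl.
have [] := simple_normal _ nN => NE; last by have : [set: G] g by []; rewrite -NE.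
by move: hN h1; rewrite NE => /= ->; rewrite eqxx.
Qed.

Lemma lambdaP h g : h != 1 -> is_sym_product h g (lambda h g) /\
  forall m, is_sym_product h g m -> (lambda h g <= m)%N.
Proof.
move=> /(sym_product_exists g) [n0 hn0].
have ex : exists n, `[< is_sym_product h g n >] by exists n0; apply/asboolP.
rewrite /lambda; case: xgetP => [x -> //|none].
case: (ex_minnP ex) => n /asboolP hn mn; case: (none n); split=> // m hm.
exact/mn/asboolP.
Qed.

Lemma lambda_gt0 h g : h != 1 -> g != 1 -> (0 < lambda h g)%N.
Proof.
move=> /(lambdaP g)[+ _] g1; case: (lambda h g) => // -[s [/size0nil -> _]].
by rewrite big_nil => gE; rewrite gE eqxx in g1.
Qed.

Lemma lambda_le1 h g : h != 1 -> g != 1 ->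
  (lambda h g <= 1)%N -> sym_class g = sym_class h.
Proof.
move=> h1 g1 le1; apply: sym_class_eq; apply/is_sym_product1.
have -> : 1%N = lambda h g by apply/eqP; rewrite eqn_leq le1 lambda_gt0.
by have [] := lambdaP g h1.
Qed.

Lemma lambda_self h : h != 1 -> lambda h h = 1%N.
Proof.
move=> h1; apply/eqP; rewrite eqn_leq lambda_gt0 // andbT.
by apply: (lambdaP h h1).2; apply/is_sym_product1/sym_class_refl.
Qed.

Lemma lambda_triangle h k g : h != 1 -> k != 1 ->
  (lambda h g <= lambda h k * lambda k g)%N.
Proof.
move=> h1 k1; apply: (lambdaP g h1).2.
exact: is_sym_product_trans (lambdaP k h1).1 (lambdaP g k1).1.
Qed.

End SimpleLambda.

Definition is_nontrivial_class (G : groupType) (C : set G) :=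
  exists2 g : G, g != 1 & C = sym_class g.

(* The metric space of classes [[g]], [g != 1].  [R] does not occur in the carrier; it is the field in which the distance
   takes its values. *)
Definition hat (R : realType) (G : groupType) : Type :=
  {C : set G | `[< is_nontrivial_class C >]}.

HB.instance Definition _ (R : realType) (G : groupType) := Choice.on (hat R G).

Section HatMetric.
Variables (R : realType) (G : simpleGroupType).
Implicit Types c : hat R G.

Definition hat_class (g : G) (g1 : g != 1) : hat R G :=
  exist _ (sym_class g) (asboolT (ex_intro2 _ _ g g1 erefl)).

Definition hat_repr c : G := s2val (cid2 (asboolW (svalP c))).

Lemma hat_repr_neq1 c : hat_repr c != 1.
Proof. exact: (s2valP (cid2 (asboolW (svalP c)))). Qed.

Lemma hat_reprK c : sym_class (hat_repr c) = sval c.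
Proof. by rewrite [RHS](s2valP' (cid2 (asboolW (svalP c)))). Qed.

(* Independent of the choice of representatives: see [hat_distE]. *)
Definition hat_dist c c' : R :=
  ln ((maxn (lambda (hat_repr c) (hat_repr c'))
            (lambda (hat_repr c') (hat_repr c)))%:R)%R.

Lemma hat_distE (g h : G) (g1 : g != 1) (h1 : h != 1) :
  hat_dist (hat_class g1) (hat_class h1) =
  ln ((maxn (lambda g h) (lambda h g))%:R)%R.
Proof.
by congr (ln (_%:R)%R); congr maxn; apply: lambda_class; rewrite hat_reprK.
Qed.

Let lam c c' := maxn (lambda (hat_repr c) (hat_repr c'))
                     (lambda (hat_repr c') (hat_repr c)).

Let lam_gt0 c c' : (0 < lam c c')%N.
Proof. by rewrite leq_max lambda_gt0 ?hat_repr_neq1. Qed.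

Let hat_distxx c : hat_dist c c = 0%R.
Proof. by rewrite /hat_dist maxnn lambda_self ?hat_repr_neq1 // ln1. Qed.

Let hat_dist_positivity c c' : hat_dist c c' = 0%R -> c = c'.
Proof.
move=> d0; apply: val_inj; rewrite /= -!hat_reprK.
apply: lambda_le1; rewrite ?hat_repr_neq1 //.
apply: (@leq_trans (lam c c')); first by rewrite leq_maxr.
rewrite leqNgt; apply/negP => gt1; have : (0 < hat_dist c c')%R.
  by rewrite ln_gt0 // ltr1n.
by rewrite d0 ltxx.
Qed.

Let hat_dist_sym c c' : hat_dist c c' = hat_dist c' c.
Proof. by rewrite /hat_dist maxnC. Qed.

Let hat_dist_triangle c' c c'' :
  (hat_dist c c'' <= hat_dist c c' + hat_dist c' c'')%R.
Proof.
rewrite /hat_dist -!/(lam _ _) -lnM ?posrE ?ltr0n // -natrM.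
rewrite ler_ln ?posrE ?ltr0n ?muln_gt0 ?lam_gt0 // ler_nat geq_max.
apply/andP; split; apply: leq_trans (lambda_triangle _ (hat_repr_neq1 _) (hat_repr_neq1 c')) _.
  by rewrite leq_mul ?leq_maxl.
by rewrite mulnC leq_mul ?leq_maxr.
Qed.

HB.instance Definition _ := isMetric.Build R (hat R G)
  hat_distxx hat_dist_positivity hat_dist_sym hat_dist_triangle.

End HatMetric.

Definition half_line (R : realType) : Type := {x : R | (0 <= x)%R}.

HB.instance Definition _ (R : realType) := Choice.on (half_line R).

Section HalfLineMetric.
Variable R : realType.
Implicit Types x y z : half_line R.

Definition half_line_dist x y : R := `|sval x - sval y|%R.

Let half_line_distxx x : half_line_dist x x = 0%R.
Proof. by rewrite /half_line_dist subrr normr0. Qed.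

Let half_line_dist_positivity x y : half_line_dist x y = 0%R -> x = y.
Proof. by move/normr0_eq0/eqP; rewrite subr_eq0 => /eqP; apply: val_inj. Qed.

Let half_line_dist_sym x y : half_line_dist x y = half_line_dist y x.
Proof. exact: distrC. Qed.

Let half_line_dist_triangle y x z :
  (half_line_dist x z <= half_line_dist x y + half_line_dist y z)%R.
Proof. exact: ler_distD. Qed.

HB.instance Definition _ := isMetric.Build R (half_line R)
  half_line_distxx half_line_dist_positivity half_line_dist_sym
  half_line_dist_triangle.

End HalfLineMetric.

Section QuasiIsometry.
Variables (R : realType) (X Y : metricType R).
Local Open Scope ring_scope.

Definition quasi_isometry (f : X -> Y) :=
  exists K e C : R, [/\ 1 <= K, 0 <= e, 0 <= C,
    forall x x', K^-1 * mdist x x' - e <= mdist (f x) (f x')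
                                       <= K * mdist x x' + e
  & forall y, exists x, mdist (f x) y <= C].

Definition quasi_isometric := exists f : X -> Y, quasi_isometry f.

End QuasiIsometry.

Definition finitary_bijection (f : nat -> nat) :=
  bijective f /\ finite_set [set i | f i <> i].

(* The positive integers are relabelled as [nat]. *)
Definition Sinf : Type := {f : nat -> nat | `[< finitary_bijection f >]}.

HB.instance Definition _ := Choice.on Sinf.

Definition Sinf_fun (f : Sinf) : nat -> nat := sval f.
Coercion Sinf_fun : Sinf >-> Funclass.

Lemma SinfP (f g : Sinf) : f =1 g -> f = g.
Proof. by move=> fg; apply: val_inj; apply/funext. Qed.

Section SinfGroup.
Implicit Types f g h : Sinf.

Let Sinf_one_subproof : finitary_bijection id.
Proof.
split; first by exists id.
by rewrite (_ : [set _ | _] = set0) // -subset0 => i /=; apply.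
Qed.

Let Sinf_mul_subproof f g : finitary_bijection (f \o g).
Proof.
case: f g => f /= /asboolP[bf ff] [g /= /asboolP[bg fg]].
split; first exact: bij_comp.
apply: (@sub_finite_set _ _ ([set i | f i <> i] `|` [set i | g i <> i])).
  move=> i /= fgi; have [gi|] := eqVneq (g i) i; last by move/eqP; right.
  by left; rewrite gi in fgi.
by rewrite finite_setU.
Qed.

Let Sinf_inv_ex f : exists f' : nat -> nat, cancel f f' /\ cancel f' f.
Proof. by case: f => f /= /asboolP[[f' fK f'K] _]; exists f'. Qed.

Let Sinf_inv_fun f := sval (cid (Sinf_inv_ex f)).

Let Sinf_inv_funK f : cancel f (Sinf_inv_fun f).
Proof. exact: (svalP (cid (Sinf_inv_ex f))).1. Qed.

Let Sinf_funK_inv f : cancel (Sinf_inv_fun f) f.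
Proof. exact: (svalP (cid (Sinf_inv_ex f))).2. Qed.

Let Sinf_inv_subproof f : finitary_bijection (Sinf_inv_fun f).
Proof.
have /asboolP[_ ff] := svalP f; split.
  by exists f; [apply: Sinf_funK_inv | apply: Sinf_inv_funK].
apply: sub_finite_set ff => i /= fi fii; apply: fi.
by rewrite -[X in Sinf_inv_fun f X]fii; apply: Sinf_inv_funK.
Qed.

Definition Sinf_one : Sinf := exist _ id (asboolT Sinf_one_subproof).
Definition Sinf_mul f g : Sinf := exist _ (f \o g) (asboolT (Sinf_mul_subproof f g)).
Definition Sinf_inv f : Sinf := exist _ (Sinf_inv_fun f) (asboolT (Sinf_inv_subproof f)).

Let Sinf_mulA : associative Sinf_mul. Proof. by move=> f g h; apply: SinfP. Qed.
Let Sinf_mul1g : left_id Sinf_one Sinf_mul. Proof. by move=> f; apply: SinfP. Qed.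
Let Sinf_mulg1 : right_id Sinf_one Sinf_mul. Proof. by move=> f; apply: SinfP. Qed.
Let Sinf_mulVg : left_inverse Sinf_one Sinf_inv Sinf_mul.
Proof. by move=> f; apply: SinfP => i; apply: Sinf_inv_funK. Qed.
Let Sinf_mulgV : right_inverse Sinf_one Sinf_inv Sinf_mul.
Proof. by move=> f; apply: SinfP => i; apply: Sinf_funK_inv. Qed.

HB.instance Definition _ := isGroup.Build Sinf
  Sinf_mulA Sinf_mul1g Sinf_mulg1 Sinf_mulVg Sinf_mulgV.

End SinfGroup.

Lemma Sinf1E i : (1 : Sinf) i = i. Proof. by []. Qed.
Lemma SinfME (f g : Sinf) i : (f * g : Sinf) i = f (g i). Proof. by []. Qed.
Lemma SinfK (f : Sinf) : cancel f (f^-1%g : Sinf).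
Proof. by move=> i; rewrite -SinfME mulVg. Qed.
Lemma SinfVK (f : Sinf) : cancel (f^-1%g : Sinf) f.
Proof. by move=> i; rewrite -SinfME mulgV. Qed.

Definition transp_fun (a b i : nat) : nat :=
  if i == a then b else if i == b then a else i.

Lemma transp_funK a b : involutive (transp_fun a b).
Proof.
move=> i; rewrite /transp_fun; have [->|ia] := eqVneq i a.
  by have [->|] := eqVneq b a; rewrite ?eqxx.
by have [->|ib] := eqVneq i b; rewrite ?eqxx ?(negPf ia) ?(negPf ib).
Qed.

Lemma transp_fun_finitary a b : finitary_bijection (transp_fun a b).
Proof.
split; first by exists (transp_fun a b); apply: transp_funK.
apply: (@sub_finite_set _ _ [set` [:: a; b]]); last exact: finite_seq.
move=> i /=; rewrite !inE /transp_fun.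
by case: eqP => //= _; case: eqP.
Qed.

Definition transp (a b : nat) : Sinf :=
  exist _ (transp_fun a b) (asboolT (transp_fun_finitary a b)).

Definition even_Sinf (f : Sinf) := exists s : seq (nat * nat),
  [/\ {in s, forall p, p.1 != p.2}, ~~ odd (size s)
    & f = \prod_(p <- s) transp p.1 p.2].

Definition even_Sinf_pred : pred Sinf := fun f => `[< even_Sinf f >].

Definition Ainf : Type := {f : Sinf | even_Sinf_pred f}.

HB.instance Definition _ := SubChoice.on Ainf.

Lemma transpE a b i :
  transp a b i = if i == a then b else if i == b then a else i.
Proof. by []. Qed.

Lemma transpL a b : transp a b a = b. Proof. by rewrite transpE eqxx. Qed.

Lemma transpR a b : transp a b b = a.
Proof. by rewrite transpE eqxx; case: eqP. Qed.

Lemma transpD a b i : i != a -> i != b -> transp a b i = i.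
Proof. by move=> /negPf ia /negPf ib; rewrite transpE ia ib. Qed.

Lemma transpC a b : transp a b = transp b a.
Proof.
apply: SinfP => i; rewrite !transpE.
by have [->|] := eqVneq i a; have [->|] := eqVneq _ b.
Qed.

Lemma transp2 a b : transp a b * transp a b = 1.
Proof. by apply: SinfP => i; apply: transp_funK. Qed.

Lemma transpV a b : (transp a b)^-1 = transp a b.
Proof. by rewrite -[LHS]mulg1 -(transp2 a b) mulgA mulVg mul1g. Qed.

Lemma transpJ (f : Sinf) a b : transp a b ^ f^-1 = transp (f a) (f b).
Proof.
rewrite /conjg invgK; apply: SinfP => i; rewrite !SinfME !transpE.
by rewrite !(can2_eq (SinfVK f) (SinfK f)) !(fun_if (Sinf_fun f)) SinfVK.
Qed.

Lemma even_SinfM f g : even_Sinf f -> even_Sinf g -> even_Sinf (f * g).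
Proof.
move=> [s [ds es ->]] [t [dt et ->]]; exists (s ++ t); split.
- by move=> p; rewrite mem_cat => /orP[/ds|/dt].
- by rewrite size_cat oddD (negPf es).
- by rewrite big_cat.
Qed.

Lemma even_SinfV f : even_Sinf f -> even_Sinf f^-1.
Proof.
move=> [s [ds es ->]]; exists (rev s); split.
- by move=> p; rewrite mem_rev => /ds.
- by rewrite size_rev.
- elim: s {ds es} => [|p s IHs]; first by rewrite !big_nil invg1.
  by rewrite big_cons invgM IHs transpV rev_cons big_rcons.
Qed.

Lemma even_Sinf_closed : group_closed even_Sinf_pred.
Proof.
split=> [|f g /asboolP ef /asboolP eg]; apply/asboolP.
  by exists [::]; rewrite big_nil.
by apply: even_SinfM => //; apply: even_SinfV.
Qed.

HB.instance Definition _ :=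
  SubChoice_isSubGroup.Build Sinf even_Sinf_pred Ainf even_Sinf_closed.

Local Ltac neqs :=
  rewrite /= ?inE ?negb_or;
  repeat match goal with
  | H : is_true (uniq _) |- _ => rewrite /= ?inE in H
  | H : is_true (_ \notin _) |- _ => rewrite !inE in H
  | H : is_true (~~ (_ || _)) |- _ => rewrite negb_or in H
  | H : is_true (_ && _) |- _ => case/andP: H => ? ?
  end;
  repeat (apply/andP; split);
  first [done | assumption | by rewrite eq_sym].

Definition cycle3 (a b c : nat) : Sinf := transp a b * transp b c.

Lemma even_transp2 a b c d :
  a != b -> c != d -> even_Sinf (transp a b * transp c d).
Proof.
move=> ab cd; exists [:: (a, b); (c, d)]; split=> //; last first.
  by rewrite big_cons big_seq1.
by move=> p; rewrite !inE => /orP[] /eqP ->.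
Qed.

Lemma even_cycle3 a b c : uniq [:: a; b; c] -> even_Sinf (cycle3 a b c).
Proof. by move=> abc; apply: even_transp2; neqs. Qed.

Lemma cycle3J (f : Sinf) a b c :
  cycle3 a b c ^ f^-1 = cycle3 (f a) (f b) (f c).
Proof. by rewrite /cycle3 conjMg !transpJ. Qed.

Lemma cycle3_rot a b c : uniq [:: a; b; c] -> cycle3 a b c = cycle3 b c a.
Proof.
move=> abc; rewrite /cycle3 conjgC; congr (_ * _).
rewrite -[X in _ ^ X]transpV transpJ transpL transpD ?(transpC a) //.
all: by neqs.
Qed.

Lemma Sinf_fresh (f : Sinf) (s : seq nat) :
  exists2 x, f x = x & x \notin s.
Proof.
have /asboolP[_ /finite_seqP[t tE]] := svalP f.
pose x := (\max_(i <- s ++ t) i).+1.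
have : x \notin s ++ t.
  by apply/negP => /(@leq_bigmax_seq _ _ predT id x) /(_ isT); rewrite ltnn.
rewrite mem_cat negb_or => /andP[xs xt]; exists x => //.
apply: contraNP xt => fx; have : [set i | sval f i <> i] x by [].
by rewrite tE.
Qed.

Section AinfSimple.
Variables (N : set Ainf) (nN : is_normal_subgroup N).

Let M : set Sinf := [set val p | p in N].

Let MM f g : M f -> M g -> M (f * g).
Proof.
have [_ NM _ _] := nN.
by move=> [p Np <-] [q Nq <-]; exists (p * q); [apply: NM | rewrite valM].
Qed.

Let valAV (p : Ainf) : val p^-1 = (val p)^-1.
Proof. by apply: (mulIg (val p)); rewrite -valM !mulVg. Qed.

Let MV f : M f -> M f^-1.
Proof.
have [_ _ NV _] := nN.
by move=> [p Np <-]; exists p^-1; [apply: NV | exact: valAV].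
Qed.

Let MJ f g : M f -> even_Sinf g -> M (f ^ g).
Proof.
have [_ _ _ NJ] := nN.
move=> [p Np <-] /asboolP eg; pose q : Ainf := exist _ g eg.
by exists (p ^ q); [apply: NJ | rewrite /conjg !valM valAV].
Qed.

Let M1 : M 1.
Proof. by have [N1 _ _ _] := nN; exists 1 => //; apply: val1. Qed.

Let M_cycle3_ex f : M f -> f != 1 ->
  exists a b c, uniq [:: a; b; c] /\ M (cycle3 a b c).
Proof.
move=> Mf f1.
have [a fa] : exists a, f a != a.
  apply: contra_neqP f1 => /forallNP fN; apply: SinfP => i.
  by apply/eqP; have /negP := fN i; rewrite negbK.
have [x fx xs] := Sinf_fresh f [:: a; f a].
have [y fy ys] := Sinf_fresh f [:: a; f a; x].
exists (f a), x, a; split; first by neqs.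
have et : even_Sinf (cycle3 a x y)^-1.
  by apply/even_SinfV/even_cycle3; neqs.
have := MM Mf (MJ (MV Mf) et); congr (M _).
have -> : f * f^-1 ^ (cycle3 a x y)^-1 =
    cycle3 a x y ^ f^-1 * (cycle3 a x y)^-1 by rewrite /conjg !invgK !mulgA.
rewrite cycle3J fx fy /cycle3 invgM !transpV -!mulgA.
by rewrite [transp x y * (_ * _)]mulgA transp2 mul1g (transpC a x).
Qed.

Let M_rot a b c : uniq [:: a; b; c] -> M (cycle3 a b c) -> M (cycle3 b c a).
Proof. by move=> abc; rewrite cycle3_rot. Qed.

Let M_replace a b c d : uniq [:: a; b; c; d] ->
  M (cycle3 a b c) -> M (cycle3 a b d).
Proof.
move=> abcd Mabc.
have [u _ us] := Sinf_fresh 1 [:: a; b; c; d].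
have [v _ vs] := Sinf_fresh 1 [:: a; b; c; d; u].
have ef : even_Sinf (transp c d * transp u v)^-1.
  by apply/even_SinfV/even_transp2; neqs.
have := MJ Mabc ef; rewrite cycle3J !SinfME.
rewrite (@transpD u v a) ?(@transpD u v b) ?(@transpD u v c); try neqs.
by rewrite transpL !transpD //; neqs.
Qed.

Let M_disjoint a b c u v w : uniq [:: a; b; c; u; v; w] ->
  M (cycle3 a b c) -> M (cycle3 u v w).
Proof.
move=> H Mabc.
apply: (@M_replace _ _ b); first by neqs.
apply: (@M_rot b); first by neqs.
apply: (@M_replace _ _ a); first by neqs.
apply: (@M_rot a); first by neqs.
by apply: (@M_replace _ _ c) => //; neqs.
Qed.

Let M_all f : M f -> f != 1 ->
  forall a b c, uniq [:: a; b; c] -> M (cycle3 a b c).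
Proof.
move=> Mf f1 a b c abc.
have [a' [b' [c' [abc' Mabc']]]] := M_cycle3_ex Mf f1.
have [u _ us] := Sinf_fresh 1 [:: a; b; c; a'; b'; c'].
have [v _ vs] := Sinf_fresh 1 [:: u; a; b; c; a'; b'; c'].
have [w _ ws] := Sinf_fresh 1 [:: u; v; a; b; c; a'; b'; c'].
apply: (@M_disjoint u v w); first by neqs.
by apply: (@M_disjoint a' b' c'); first by neqs.
Qed.

Let M_even f : M f -> f != 1 -> forall g, even_Sinf g -> M g.
Proof.
move=> Mf f1; have M3 a b c : a != b -> b != c -> M (transp a b * transp b c).
  move=> ab bc; have [<-|ac] := eqVneq a c.
    by rewrite (transpC b) transp2.
  by apply: (M_all Mf f1); neqs.
have M2 a b c d : a != b -> c != d -> M (transp a b * transp c d).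
  move=> ab cd; have [bc|bc] := eqVneq b c; first by rewrite -bc in cd *; apply: M3.
  have -> : transp a b * transp c d =
      (transp a b * transp b c) * (transp b c * transp c d).
    by rewrite -!mulgA [transp b c * (_ * _)]mulgA transp2 mul1g.
  by apply: MM; apply: M3.
move=> g [s [ds es ->]]; move: {2}(size s) (leqnn (size s)) => n.
elim: n s ds es => [|n IHn] [|p [|q s]] //= ds es sn; rewrite ?big_nil //.
rewrite !big_cons mulgA; apply: MM.
  by apply: M2; apply: ds; rewrite !inE eqxx ?orbT.
apply: IHn; last exact: leq_trans (leqnSn _) sn.
  by move=> r rs; apply: ds; rewrite !inE rs !orbT.
by rewrite negbK in es.
Qed.

Lemma Ainf_normal : N = [set 1] \/ N = [set: Ainf].
Proof.
have [N1 _ _ _] := nN; have [[p [Np p1]]|none] :=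
  pselect (exists p, N p /\ p != 1); [right | left]; apply/seteqP; split=> //.
- move=> q _; have p1' : val p != 1.
    by apply: contra_neq p1 => p1; apply: val_inj; rewrite p1 val1.
  have Mp : M (val p) by exists p.
  have [r Nr /val_inj <- //] := M_even Mp p1' (asboolW (valP q)).
- move=> p Np; apply/eqP/negPn/negP => p1; apply: none; by exists p.
- by move=> _ ->.
Qed.

End AinfSimple.

Lemma Ainf_nontrivial : exists g : Ainf, g != 1.
Proof.
have /asboolP e : even_Sinf (cycle3 0 1 2) by apply: even_cycle3.
exists (exist _ (cycle3 0 1 2) e); apply/eqP.
by move=> /(congr1 val) /(congr1 (fun f : Sinf => f 0%N)); rewrite val1.
Qed.

HB.instance Definition _ :=
  isSimpleGroup.Build Ainf Ainf_nontrivial Ainf_normal.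

(* Main.v *)
Require Import Defs.
From mathcomp Require Import all_boot all_order all_fingroup all_algebra.
From mathcomp Require Import all_classical all_reals all_analysis.
From mathcomp Require Import zify lra.

(** The invariant behind the quasi-isometry is the support size n(g), the
    number of points moved by g; the map sends [g] to ln n(g).  It is enough to
    compare lambda_h(g) with n(g) / n(h) up to a multiplicative constant, since
    the metric takes logarithms:

      n(g) <= lambda_h(g) n(h)   and   lambda_h(g) n(h) <= 16 (n(g) + n(h)).

    The first bound is subadditivity of the support size
    ([size_supp_sym_product]).  For the second one, everything is done in the
    group of all finitary permutations: conjugating by an odd permutation can be
    corrected by a transposition of two points fixed by the conjugated element
    ([Ainf_conj_lift]), so that both groups give the same word length
    ([Ainf_sym_product]).  There,

    - a greedy choice gives a set s of at least n(h) / 3 points which h maps to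
      a set disjoint from s ([displaced_ex]);
    - if k exchanges each point a of s with a fresh point x, then h times the
      inverse of h conjugated by k is a product of |s| disjoint 3-cycles
      (h a, x, a) ([commutator_cycles3]); hence every product of at most |s|
      disjoint 3-cycles is a product of two elements of [h];
    - a double transposition is a product of two 3-cycles on its own four
      points, so every product of at most |s| disjoint double transpositions is
      a product of four elements of [h] ([sym_product_transps] with q = 1), and
      a product of N of them is a product of about 4 N / |s| elements;
    - like every permutation, g is a product of two involutions supported in
      its own support, obtained by reflecting each orbit ([two_involutions]);
      when g is even both can be made even at the cost of two extra points
      ([even_transps]), and an even involution is a product of disjoint double
      transpositions.

    Adding up, lambda_h(g) is at most a constant times n(g) / n(h) + 1
    ([sym_product_even]).  Finally every positive multiple of 4 is a support
    size ([supp_card_ex]), so the image of the map is coarsely dense in the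
    half-line. *)

Set Implicit Arguments.
Unset Strict Implicit.
Unset Printing Implicit Defensive.

Import Order.TTheory GRing.Theory Num.Theory.

Local Open Scope classical_set_scope.
Local Open Scope group_scope.

(** * Supports of finitary permutations *)

Lemma supp_ex (f : Sinf) :
  exists s : seq nat, uniq s /\ forall i, (i \in s) = (f i != i).
Proof.
have /asboolP[_ /finite_seqP[t tE]] := svalP f.
exists (undup t); split=> [|i]; first exact: undup_uniq.
rewrite mem_undup; apply/idP/idP => [it|/eqP fi].
  by apply/eqP; have : [set` t] i by []; rewrite -tE.
by have : [set i | sval f i <> i] i by []; rewrite tE.
Qed.

Definition supp (f : Sinf) : seq nat := sval (cid (supp_ex f)).

Arguments supp f%_g.

Lemma supp_uniq f : uniq (supp f).
Proof. exact: (svalP (cid (supp_ex f))).1. Qed.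

Lemma mem_supp f i : (i \in supp f) = (f i != i).
Proof. exact: (svalP (cid (supp_ex f))).2. Qed.

Lemma Sinf_inj (f : Sinf) : injective f.
Proof. exact: can_inj (SinfK f). Qed.

Lemma size_suppM (f g : Sinf) :
  (size (supp (f * g)) <= size (supp f) + size (supp g))%N.
Proof.
rewrite -size_cat; apply: uniq_leq_size; first exact: supp_uniq.
move=> i; rewrite mem_cat !mem_supp SinfME.
by apply: contraNT; rewrite negb_or !negbK => /andP[/eqP fi /eqP ->]; apply/eqP.
Qed.

Lemma size_suppJ (f g : Sinf) : (size (supp (f ^ g)) <= size (supp f))%N.
Proof.
rewrite -(size_map (g^-1%g : Sinf) (supp f)).
apply: uniq_leq_size; first exact: supp_uniq.
move=> i; rewrite mem_supp => fgi; apply/mapP; exists (g i); last by rewrite SinfK.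
rewrite mem_supp; apply: contraNN fgi => /eqP fgi.
by rewrite /conjg !SinfME fgi SinfK.
Qed.

Lemma size_suppV (f : Sinf) : (size (supp f^-1) <= size (supp f))%N.
Proof.
apply: uniq_leq_size; first exact: supp_uniq.
by move=> i; rewrite !mem_supp; apply: contraNN => /eqP {1}<-; rewrite SinfK.
Qed.

Lemma supp_gt0 f : f != 1 -> (0 < size (supp f))%N.
Proof.
apply: contra_neqT; rewrite -eqn0Ngt => /nilP f0; apply: SinfP => i.
by apply/eqP; rewrite -[_ == _]negbK -mem_supp f0.
Qed.

(** Conjugation and inversion preserve the support size and multiplication is
    subadditive for it, which gives the lower bound on word lengths. *)
Lemma size_supp_sym_product h g n :
  is_sym_product h g n -> (size (supp g) <= n * size (supp h))%N.
Proof.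
move=> [s [<- + ->]]; elim: s => [|x s IHs] hs.
  rewrite big_nil mul0n leqn0; apply/nilP.
  by case E: (supp 1) (mem_supp 1) => [//|i t] /(_ i); rewrite mem_head eqxx.
rewrite big_cons /= mulSn; apply: leq_trans (size_suppM _ _) _; apply: leq_add.
  case: (hs x (mem_head _ _)) => -[y _ <-]; first exact: size_suppJ.
  exact: leq_trans (size_suppJ _ _) (size_suppV _).
by apply: IHs => y ys; apply: hs; rewrite inE ys orbT.
Qed.

(** * Products of disjoint transpositions and of disjoint 3-cycles *)

(** Any finite partial injection extends to a finitary permutation: this is what
    makes two products of disjoint cycles of the same shape conjugate. *)
Lemma Sinf_map_ex (u v : seq nat) : uniq u -> uniq v -> size u = size v ->
  exists f : Sinf, map f u = v.
Proof.
elim: u v => [|a u IHu] [|b v] //=; first by exists 1.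
move=> /andP[au uu] /andP[bv uv] [/(IHu _ uu uv)[f fu]].
exists (transp (f a) b * f); rewrite SinfME transpL; congr (_ :: _).
rewrite -[RHS]fu; apply/eq_in_map => i iu; rewrite SinfME transpD //.
  by rewrite (inj_eq (@Sinf_inj f)); apply: contraNneq au => <-.
by apply: contraNneq bv => <-; rewrite -fu map_f.
Qed.

Lemma mulg_transp (f : Sinf) a b : f * transp a b = transp (f a) (f b) * f.
Proof. by rewrite -transpJ /conjg invgK mulgA mulgKV. Qed.

(** Cycle decompositions are stored as flat lists of points, so that disjointness
    is [uniq] and conjugation is [map].  Points beyond the last complete block
    are ignored. *)
Fixpoint transps (l : seq nat) : Sinf :=
  if l is a :: b :: l' then transp a b * transps l' else 1.

Fixpoint cycles3 (l : seq nat) : Sinf :=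
  if l is a :: b :: c :: l' then cycle3 a b c * cycles3 l' else 1.

Lemma pair_seq_ind (T : Type) (P : seq T -> Prop) :
  P [::] -> (forall a b l, P l -> P [:: a, b & l]) ->
  forall l, ~~ odd (size l) -> P l.
Proof.
move=> P0 P2 l; have [n] := ubnP (size l).
elim: n l => [//|n IHn] [//|a [//|b l]] /=; rewrite negbK => ln el.
by apply/P2/IHn => //; lia.
Qed.

Lemma triple_seq_ind (T : Type) (P : seq T -> Prop) :
  P [::] -> (forall a b c l, P l -> P [:: a, b, c & l]) ->
  forall l, (3 %| size l)%N -> P l.
Proof.
move=> P0 P3 l; have [n] := ubnP (size l).
elim: n l => [//|n IHn] [//|a [//|b [//|c l]]] /= ln el.
by apply/P3/IHn; lia.
Qed.

Lemma transps_cat l1 l2 : ~~ odd (size l1) ->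
  transps (l1 ++ l2) = transps l1 * transps l2.
Proof.
by move: l1; apply: pair_seq_ind => [|a b l IHl] /=; rewrite ?mul1g // IHl mulgA.
Qed.

Lemma transps_fix l i : ~~ odd (size l) -> i \notin l -> transps l i = i.
Proof.
move: l; apply: pair_seq_ind => // a b l IHl.
rewrite !inE !negb_or => /and3P[ia ib il].
by rewrite [transps _]/= SinfME IHl // transpD.
Qed.

Lemma cycles3_fix l i : (3 %| size l)%N -> i \notin l -> cycles3 l i = i.
Proof.
move: l; apply: triple_seq_ind => // a b c l IHl.
rewrite !inE !negb_or => /and4P[ia ib ic il].
by rewrite [cycles3 _]/= /cycle3 !SinfME IHl // !transpD.
Qed.

Lemma cycles3J (f : Sinf) l : (3 %| size l)%N ->
  cycles3 l ^ f^-1 = cycles3 (map f l).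
Proof.
move: l; apply: triple_seq_ind => [|a b c l IHl] /=; first by rewrite conj1g.
by rewrite conjMg cycle3J IHl.
Qed.

(** * Words in conjugates of a permutation and of its inverse *)

(** With k the product of the transpositions of each a in s with a fresh x fixed
    by h, the element h (k h^-1 k^-1) is (h k h^-1) k^-1, and h k h^-1 is the
    product of the transpositions of h a with x; the two transpositions sharing
    x compose to a 3-cycle.  The list z only serves the induction: it keeps the
    fresh points of the tail away from the current a and h a. *)
Lemma commutator_cycles3 (h : Sinf) (s z : seq nat) : uniq (s ++ map h s) ->
  exists (k : Sinf) (l : seq nat), [/\ uniq l, size l = (3 * size s)%N,
    {in l, forall y, (y \in s ++ map h s) || (y \notin z)}
    & h * h^-1 ^ k = cycles3 l].
Proof.
suff H : uniq (s ++ map h s) ->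
    exists (k : Sinf) (l : seq nat), [/\ uniq l, size l = (3 * size s)%N,
    {in l, forall y, (y \in s ++ map h s) || (y \notin z)}
    & k ^ h^-1 * k^-1 = cycles3 l].
  move=> /H[k [l [ul sl lz E]]]; exists k^-1, l; split=> //.
  by rewrite -E /conjg !invgK !mulgA.
elim: s z => [|a s IHs] z; first by exists 1, [::]; rewrite conj1g mul1g invg1.
rewrite map_cons cat_uniq /= negb_or -!andbA => /and5P[as_ us].
rewrite inE negb_or => /andP[haa has_] nh /andP[hahs uhs].
have {as_} [anhs ans] : a \notin map h s /\ a \notin s.
  split=> //; apply: contraNN nh => ahs.
  by apply/hasP; exists a; rewrite // mem_head.
have uss : uniq (s ++ map h s).
  rewrite cat_uniq us uhs andbT; apply: contraNN nh => /hasP[x xh xs].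
  by apply/hasP; exists x; rewrite // inE xs orbT.
have [k [l [ul sl lz kE]]] := IHs [:: a, h a & z] uss.
have [x hx] := Sinf_fresh h (a :: h a :: z ++ l).
rewrite !inE !negb_or mem_cat negb_or => /and4P[xa xha xz xl].
have l3 : (3 %| size l)%N by rewrite sl dvdn_mulr.
have al : a \notin l.
  apply/negP => /lz; rewrite mem_cat (negPf ans) (negPf anhs) /=.
  by rewrite mem_head.
have hal : h a \notin l.
  apply/negP => /lz; rewrite mem_cat (negPf has_) (negPf hahs) /=.
  by rewrite !inE eqxx orbT.
exists (transp a x * k), [:: h a, x, a & l]; split.
- rewrite /= !inE !negb_or ul al hal xl xa haa andbT /=.
  by rewrite eq_sym xha.
- by rewrite /= sl; lia.
- move=> y; rewrite !inE => /or4P[/eqP->|/eqP->|/eqP->|yl].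
  + by rewrite mem_cat mem_head !orbT.
  + by rewrite xz orbT.
  + by rewrite eqxx.
  have := lz y yl; rewrite !mem_cat !inE !negb_or.
  by case/orP => [/orP[]->|/and3P[_ _ ->]]; rewrite ?orbT.
- rewrite conjMg transpJ hx invgM transpV -mulgA [k ^ _ * _]mulgA kE.
  rewrite mulg_transp !cycles3_fix // mulgA; congr (_ * _).
  by rewrite /cycle3 (transpC a x).
Qed.

(** The first size l / 3 points of s give, by [commutator_cycles3], a conjugate
    of [cycles3 l]. *)
Lemma sym_product_cycles3 (h : Sinf) (s l : seq nat) :
  uniq (s ++ map h s) -> uniq l -> (3 %| size l)%N ->
  (size l <= 3 * size s)%N -> is_sym_product h (cycles3 l) 2.
Proof.
move=> us ul /dvdnP[j lj] ls.
have js : (j <= size s)%N by lia.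
have ut : uniq (take j s ++ map h (take j s)).
  apply: subseq_uniq us; apply: cat_subseq; first exact: take_subseq.
  exact/map_subseq/take_subseq.
have [k [l' [ul' sl' _ hk]]] := commutator_cycles3 [::] ut.
rewrite size_takel // in sl'.
have [f <-] : exists f : Sinf, map f l' = l by apply: Sinf_map_ex => //; lia.
rewrite -cycles3J -?hk ?sl' ?dvdn_mulr //; apply: is_sym_productJ.
apply: (@is_sym_productM _ _ _ _ 1 1); apply/is_sym_product1.
  exact: sym_class_refl.
exact/sym_classJ/sym_classV/sym_class_refl.
Qed.

Lemma mulg_cycle3 (f : Sinf) a b c :
  f * cycle3 a b c = cycle3 (f a) (f b) (f c) * f.
Proof. by rewrite -cycle3J conjgE invgK -!mulgA mulVg mulg1. Qed.

Lemma quad_seq_ind (T : Type) (P : seq T -> Prop) :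
  P [::] -> (forall a b c d l, P l -> P [:: a, b, c, d & l]) ->
  forall l, (4 %| size l)%N -> P l.
Proof.
move=> P0 P4 l; have [n] := ubnP (size l).
elim: n l => [//|n IHn] [//|a [//|b [//|c [//|d l]]]] /= ln el.
by apply/P4/IHn; lia.
Qed.

(** Blockwise (a b)(c d) = ((a b)(b c)) ((b c)(c d)); blocks are disjoint, so the
    left factors can be collected before the right ones. *)
Lemma transps_cycles3 (l : seq nat) : uniq l -> (4 %| size l)%N ->
  exists u v : seq nat, [/\ uniq u, uniq v, (4 * size u = 3 * size l)%N,
    (4 * size v = 3 * size l)%N & transps l = cycles3 u * cycles3 v].
Proof.
suff H : (4 %| size l)%N -> uniq l ->
  exists u v : seq nat, [/\ uniq u, uniq v,
    (4 * size u = 3 * size l)%N /\ (4 * size v = 3 * size l)%N,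
    {subset u <= l} /\ {subset v <= l} & transps l = cycles3 u * cycles3 v].
  by move=> ul /H -/(_ ul)[u [v [? ? [? ?] _ ?]]]; exists u, v.
move: l; apply: quad_seq_ind => [_|a b c d l IHl].
  by exists [::], [::]; split=> //=; rewrite mulg1.
rewrite (@cat_uniq _ [:: a; b; c; d]) => /and3P[abcd dl].
move=> /IHl[u [v [uu uv [su sv] [ul vl] lE]]].
have nl x : x \in [:: a; b; c; d] -> x \notin l.
  by move=> xs; apply: contraNN dl => xl; apply/hasP; exists x.
have l4 : (4 %| size l)%N by rewrite -(@Gauss_dvdr _ 3) // -su dvdn_mulr.
have u3 : (3 %| size u)%N by rewrite -(@Gauss_dvdr _ 4) // su dvdn_mulr.
exists [:: a, b, c & u], [:: b, c, d & v]; split.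
- rewrite (@cat_uniq _ [:: a; b; c]) uu andbT.
  rewrite (@cat_uniq _ [:: a; b; c] [:: d]) in abcd.
  have /andP[-> _] := abcd; apply/hasPn => x /ul xl.
  apply: contraL xl => xs; apply: nl.
  by move: xs; rewrite !inE => /or3P[] ->; rewrite ?orbT.
- rewrite (@cat_uniq _ [:: b; c; d]) uv andbT.
  rewrite (@cat_uniq _ [:: a] [:: b; c; d]) in abcd.
  have /and3P[_ _ ->] := abcd; apply/hasPn => x /vl xl.
  apply: contraL xl => xs; apply: nl.
  by move: xs; rewrite !inE => /or3P[] ->; rewrite ?orbT.
- by rewrite /=; split; lia.
- split=> x; rewrite !inE => /or4P[->|->|->|]; rewrite ?orbT //.
    by move=> /ul ->; rewrite ?orbT.
  by move=> /vl ->; rewrite ?orbT.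
- rewrite /= lE -mulgA [cycles3 u * (_ * _)]mulgA mulg_cycle3.
  have fu x : x \in [:: a; b; c; d] -> cycles3 u x = x.
    by move=> /nl xl; apply: cycles3_fix => //; apply: contraNN xl => /ul.
  rewrite !fu ?inE ?eqxx ?orbT // /cycle3 -!mulgA; congr (_ * _).
  by rewrite [transp b c * (_ * _)]mulgA transp2 mul1g.
Qed.

(** The list is cut into q chunks of at most [size s] double transpositions.  An
    empty chunk also costs exactly four factors, hence the length is [4 * q] and
    not merely at most [4 * q]. *)
Lemma sym_product_transps (h : Sinf) (s l : seq nat) q :
  uniq (s ++ map h s) -> uniq l -> (4 %| size l)%N ->
  (size l <= 4 * size s * q)%N -> is_sym_product h (transps l) (4 * q).
Proof.
move=> us; elim: q l => [|q IHq] l ul l4 ls.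
  have -> : l = [::] by apply/size0nil; lia.
  exact: is_sym_product0.
pose n := minn (size l) (4 * size s).
have tl : size (take n l) = n by rewrite size_takel // geq_minl.
have n4 : (4 %| n)%N by rewrite /n /minn; case: ifP => // _; rewrite dvdn_mulr.
rewrite -(cat_take_drop n l) transps_cat; last by rewrite tl; lia.
rewrite mulnS; apply: is_sym_productM.
  have ut : uniq (take n l) by apply: take_uniq.
  have [|u [v [uu uv su sv ->]]] := transps_cycles3 ut; first by rewrite tl.
  rewrite tl in su sv.
  apply: (@is_sym_productM _ _ _ _ 2 2).
    by apply: (sym_product_cycles3 us) => //; lia.
  by apply: (sym_product_cycles3 us) => //; lia.
by apply: IHq; rewrite ?drop_uniq ?size_drop //; lia.
Qed.

(** Points are added to s greedily; a point x is rejected only when x, h x or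
    h^-1 x obstructs, so in the end s, h(s) and h^-1(s) cover the support. *)
Lemma displaced_ex (h : Sinf) :
  exists s : seq nat, uniq (s ++ map h s) /\ (size (supp h) <= 3 * size s)%N.
Proof.
suff [s [us hs]] : exists s : seq nat, uniq (s ++ map h s) /\
    {subset supp h <= s ++ map h s ++ map (h^-1%g : Sinf) s}.
  exists s; split=> //; have := uniq_leq_size (supp_uniq h) hs.
  by rewrite !size_cat !size_map /=; lia.
have: {in supp h, forall x, h x != x} by move=> x; rewrite mem_supp.
elim: (supp h) => [_|x l IHl hl]; first by exists [::].
have [|s [us ls]] := IHl; first by move=> y yl; apply: hl; rewrite inE yl orbT.
have [xs|xs] := boolP (x \in s ++ map h s ++ map (h^-1%g : Sinf) s).
  by exists s; split=> // y; rewrite inE => /predU1P[->|/ls].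
exists (x :: s); split; last first.
  move=> y; rewrite inE => /predU1P[->|/ls]; first by rewrite mem_head.
  by rewrite !(mem_cat, inE) => /or3P[] ->; rewrite ?orbT.
have hx := hl x (mem_head _ _).
move: xs; rewrite !mem_cat !negb_or => /and3P[xs xhs xVs].
rewrite -[map h _]cat1s uniq_catCA /= us andbT inE !mem_cat !negb_or hx xs xhs.
rewrite (mem_map (@Sinf_inj h)) xs !andbT; apply: contraNN xVs => hxs.
by rewrite -[x](SinfK h) map_f.
Qed.

(** * Factoring into involutions *)

(** A moved point a gives the factor (a, f a); multiplying by it leaves an
    involution with a smaller support, which no longer contains a nor f a. *)
Lemma involution_transps (f : Sinf) : f * f = 1 ->
  exists l : seq nat, [/\ uniq l, ~~ odd (size l), {subset l <= supp f}
    & f = transps l].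
Proof.
have [n] := ubnP (size (supp f)); elim: n f => [//|n IHn] f fn ff.
have [->|f1] := eqVneq f 1; first by exists [::].
have ffK i : f (f i) = i by rewrite -SinfME ff.
case E: (supp f) => [|a t]; first by have := supp_gt0 f1; rewrite E.
have fa : f a != a by rewrite -mem_supp E mem_head.
pose g : Sinf := transp a (f a) * f.
have gff : g = f * transp a (f a) by rewrite mulg_transp ffK transpC.
have gg : g * g = 1 by rewrite {1}gff /g mulgA -(mulgA f) transp2 mulg1.
have ga : g a = a by rewrite SinfME transpR.
have gfa : g (f a) = f a by rewrite SinfME ffK transpL.
have gf : {subset supp g <= supp f}.
  move=> i; rewrite !mem_supp; apply: contraNN => /eqP fi.
  rewrite SinfME fi transpD //; apply: contraNneq fa => ia; first by rewrite -ia fi.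
  by rewrite -[in X in _ == X](ffK a) -ia fi.
have sg : (size (supp g) < size (supp f))%N.
  have : {subset a :: supp g <= supp f}.
    by move=> i; rewrite inE => /predU1P[->|/gf //]; rewrite mem_supp.
  by apply: uniq_leq_size; rewrite /= supp_uniq mem_supp ga eqxx.
have [|l [ul el lg gE]] := IHn g _ gg; first exact: leq_trans sg _.
exists [:: a, f a & l]; split.
- rewrite /= inE negb_or eq_sym fa ul andbT /=.
  by apply/andP; split; apply/negP => /lg; rewrite mem_supp ?ga ?gfa eqxx.
- by rewrite /= negbK.
- rewrite -E => i; rewrite !inE => /or3P[/eqP->|/eqP->|/lg /gf //]; rewrite mem_supp //.
  by rewrite ffK eq_sym.
- by rewrite /= -gE /g mulgA transp2 mul1g.
Qed.

Lemma Sinf_of_involution (f : nat -> nat) (g : Sinf) : involutive f ->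
  (forall x, g x = x -> f x = x) ->
  exists j : Sinf, [/\ j =1 f, j * j = 1 & {subset supp j <= supp g}].
Proof.
move=> ff fg; have ffin : finitary_bijection f.
  split; first by exists f.
  apply: sub_finite_set (finite_seq (supp g)) => x fx /=.
  by rewrite mem_supp; apply/eqP => /fg.
exists (exist _ f (asboolT ffin)); split=> [//||x].
  by apply: SinfP => x; apply: ff.
by rewrite !mem_supp; apply: contraNN => /eqP gx; apply/eqP/fg.
Qed.

(** Choose a base point r in each orbit and let s exchange g^i r and g^-i r; then
    s and g s are involutions, as for a dihedral group acting on a cycle.  To
    avoid integer powers, x = g^(n-m) r is written g^m x = g^n r, and the
    reflected point y is then determined by g^n y = g^m r. *)
Lemma two_involutions (g : Sinf) : exists i j : Sinf,
  [/\ i * i = 1, j * j = 1, {subset supp i <= supp g},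
      {subset supp j <= supp g} & g = i * j].
Proof.
have iter_inj n : injective (iter n g).
  by elim: n => [|n IHn] x y //= /(@Sinf_inj g) /IHn.
have iter_swap m n x : iter m g (iter n g x) = iter n g (iter m g x).
  by rewrite -!iterD addnC.
have iter_fix n x : g x = x -> iter n g x = x by move=> gx; elim: n => //= n ->.
pose orb x := [set y | exists m n, iter m g x = iter n g y].
have orb_eq x y : orb x y -> orb y = orb x.
  move=> [m [n xy]]; apply/seteqP; split=> z [k [l yz]].
    by exists (k + m)%N, (n + l)%N; rewrite !iterD xy iter_swap yz.
  by exists (k + n)%N, (m + l)%N; rewrite !iterD -xy iter_swap yz.
have orbxx x : orb x x by exists 0%N, 0%N.
pose r x := xget 0%N (orb x).
have r_orb x : orb x (r x) by apply: (xgetPex 0%N); exists x.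
pose refl x y := r y = r x /\
  exists m n, iter m g x = iter n g (r x) /\ iter n g y = iter m g (r x).
have refl_ex x : exists y, refl x y.
  have [m [n xr]] := r_orb x; have [g' gK Kg] : bijective (iter n g).
    elim: (n) => [|k IHk]; first by exists id.
    by apply: bij_comp IHk; exists (g^-1%g : Sinf); [apply: SinfK|apply: SinfVK].
  exists (g' (iter m g (r x))); split; last by exists m, n; rewrite Kg.
  rewrite /r (orb_eq x) //; exists (m + m)%N, (n + n)%N.
  by rewrite !iterD Kg xr iter_swap.
have refl_uniq x y z : refl x y -> refl x z -> y = z.
  move=> [_ [m [n [xr yr]]]] [_ [k [l [xr' zr]]]].
  apply: (iter_inj (l + n)%N); rewrite iterD yr iter_swap -xr' iter_swap xr.
  by rewrite iter_swap -zr iter_swap -iterD.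
have refl_sym x y : refl x y -> refl y x.
  by move=> [ryx [m [n [xr yr]]]]; split=> //; exists n, m; rewrite ryx.
have refl_shift x y : refl x y -> refl (g y) ((g^-1%g : Sinf) x).
  move=> [ryx [m [n [xr yr]]]].
  have rg z : r (g z) = r z.
    by rewrite /r (orb_eq z) //; exists 1%N, 0%N.
  split; first by rewrite rg ryx -[in RHS](SinfVK g x) rg.
  exists n, m.+1; rewrite rg ryx; split; first by rewrite -iterSr iterS yr.
  by rewrite iterSr SinfVK.
have [s sP] := choice refl_ex.
have s_fix x : g x = x -> s x = x.
  move=> gx; apply: refl_uniq (sP x) _; split=> //.
  have [m [n]] := r_orb x; rewrite iter_fix // => xr.
  have rx : r x = x by apply: (iter_inj n); rewrite -xr iter_fix.
  by exists m, n; rewrite rx !iter_fix.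
have ss : involutive s by move=> x; apply: refl_uniq (sP _) (refl_sym _ _ (sP x)).
have [j [jE jj jg]] := Sinf_of_involution ss s_fix.
exists (g * j), j; split=> //; last by rewrite -mulgA jj mulg1.
- apply: SinfP => x; rewrite !SinfME !jE.
  by rewrite (refl_uniq _ _ _ (sP _) (refl_shift _ _ (sP x))) SinfVK.
- move=> x; rewrite !mem_supp; apply: contraNN => /eqP gx.
  by rewrite SinfME jE s_fix // gx.
Qed.

(** * Parity *)

(** All the transpositions live on some finite ordinal, where the parity of a
    permutation is available.  The list is reversed because permutations of a
    finite type compose in the opposite order. *)
Lemma transp_prod_eq1_even (s : seq (nat * nat)) :
  {in s, forall p, p.1 != p.2} -> \prod_(p <- s) transp p.1 p.2 = 1 ->
  ~~ odd (size s).
Proof.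
move=> sn s1; pose N := (\max_(p <- s) maxn p.1 p.2)%N.
have sN : {in s, forall p, (p.1 <= N)%N /\ (p.2 <= N)%N}.
  move=> p ps; apply/andP; rewrite -geq_max.
  exact: (@leq_bigmax_seq _ _ predT (fun p : nat * nat => maxn p.1 p.2)).
pose o (p : nat * nat) : 'I_N.+1 * 'I_N.+1 := (inord p.1, inord p.2).
have oE : {in s, forall p (i : 'I_N.+1),
    tperm (o p).1 (o p).2 i = transp p.1 p.2 i :> nat}.
  move=> p /sN[p1 p2] i; rewrite transpE; case: tpermP => [->|->|].
  - by rewrite /= !inordK // eqxx.
  - by rewrite /= !inordK // eqxx; case: eqP => // ->.
  - move=> /eqP i1 /eqP i2; rewrite ifN ?ifN //.
    by apply: contraNneq i2 => i2; apply/eqP/val_inj; rewrite /= inordK.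
  by apply: contraNneq i1 => i1; apply/eqP/val_inj; rewrite /= inordK.
have : odd_perm (\prod_(t <- map o (rev s)) tperm t.1 t.2) = odd (size s).
  rewrite odd_perm_prod ?size_map ?size_rev //.
  apply/allP => _ /mapP[p + ->]; rewrite mem_rev => ps.
  apply: contraNneq (sn p ps) => /(congr1 val) /=.
  by have [? ?] := sN p ps; rewrite !inordK ?ltnS // => ->.
move=> <-; suff -> : \prod_(t <- map o (rev s)) tperm t.1 t.2 = 1%g.
  by rewrite odd_perm1.
apply/permP => i; apply: val_inj; rewrite perm1 -[RHS](Sinf1E (i : nat)) -s1.
have : {subset s <= s} by []; elim: {1 3 4}s => [|p t IHt] ts.
  by rewrite !big_nil perm1.
rewrite rev_cons map_rcons big_rcons /= big_cons permM oE ?ts ?mem_head //.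
by rewrite IHt // => q qt; apply: ts; rewrite inE qt orbT.
Qed.

(** * Upper bound on word lengths of even permutations *)

Lemma transps_prod (l : seq nat) : ~~ odd (size l) -> uniq l ->
  exists s : seq (nat * nat), [/\ {in s, forall p, p.1 != p.2},
    size l = (2 * size s)%N & transps l = \prod_(p <- s) transp p.1 p.2].
Proof.
move: l; apply: pair_seq_ind => [_|a b l IHl].
  by exists [::]; rewrite big_nil.
rewrite /= inE negb_or -andbA => /and4P[ab _ _ /IHl[s [sn sl lE]]].
exists ((a, b) :: s); split; last by rewrite big_cons lE.
  by move=> p; rewrite inE => /predU1P[->|/sn].
by rewrite /= sl mulnS.
Qed.

Lemma transp_generation (g : Sinf) : exists s : seq (nat * nat),
  {in s, forall p, p.1 != p.2} /\ g = \prod_(p <- s) transp p.1 p.2.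
Proof.
have [i [j [/involution_transps[l [ul el _ ->]]]]] := two_involutions g.
move=> /involution_transps[k [uk ek _ ->]] _ _ ->.
have [s [sn _ ->]] := transps_prod el ul.
have [t [tn _ ->]] := transps_prod ek uk.
exists (s ++ t); split; rewrite ?big_cat // => p.
by rewrite mem_cat => /orP[/sn|/tn].
Qed.

(** By parity the two involutions of [two_involutions] are both even or both odd;
    in the odd case, a transposition of two fresh points is inserted twice
    between them. *)
Lemma even_transps (g : Sinf) : even_Sinf g -> exists l k : seq nat,
  [/\ uniq l /\ uniq k, (4 %| size l)%N /\ (4 %| size k)%N,
      (size l <= size (supp g) + 2)%N /\ (size k <= size (supp g) + 2)%N
    & g = transps l * transps k].
Proof.
move=> eg; have [i [j [ii jj ig jg gE]]] := two_involutions g.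
have [l [ul el li iE]] := involution_transps ii.
have [k [uk ek kj jE]] := involution_transps jj.
have lg : {subset l <= supp g} by move=> x /li /ig.
have kg : {subset k <= supp g} by move=> x /kj /jg.
have ls : (size l <= size (supp g))%N by apply: uniq_leq_size.
have ks : (size k <= size (supp g))%N by apply: uniq_leq_size.
have {}gE : g = transps l * transps k by rewrite gE iE jE.
have lk4 : (4 %| size l + size k)%N.
  have [s [sn sl sE]] := transps_prod el ul.
  have [t [tn tl tE]] := transps_prod ek uk.
  have [r [rn er rE]] := even_SinfV eg.
  have : ~~ odd (size (r ++ s ++ t)).
    apply: transp_prod_eq1_even.
      by move=> p; rewrite !mem_cat => /or3P[/rn|/sn|/tn].
    by rewrite !big_cat /= -rE -sE -tE -gE mulVg.
  by rewrite !size_cat; lia.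
have [l4|l4] := boolP (4 %| size l)%N.
  by exists l, k; split=> //; split=> //; lia.
have [u gu _] := Sinf_fresh g [::].
have [v gv] := Sinf_fresh g [:: u]; rewrite inE => vu.
have ug : u \notin supp g by rewrite mem_supp gu eqxx.
have vg : v \notin supp g by rewrite mem_supp gv eqxx.
exists (l ++ [:: u; v]), [:: u, v & k]; split.
- split.
    rewrite cat_uniq ul /= inE eq_sym vu orbF !andbT negb_or.
    by rewrite (contraNN (@lg u)) ?(contraNN (@lg v)).
  rewrite /= inE eq_sym negb_or vu uk andbT.
  by rewrite (contraNN (@kg u)) ?(contraNN (@kg v)).
- by rewrite size_cat /=; split; lia.
- by rewrite size_cat /=; split; lia.
- rewrite transps_cat //= mulg1 -mulgA [transp u v * (_ * _)]mulgA transp2 mul1g.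
  exact: gE.
Qed.

(** Both involutions of [even_transps] are cut into chunks of |s| double
    transpositions, where h moves s off itself and 3 |s| >= n(h). *)
Lemma sym_product_even (h g : Sinf) : h != 1 -> even_Sinf g ->
  is_sym_product h g (16 * (size (supp g) %/ size (supp h)).+1).
Proof.
move=> /supp_gt0 h0 /even_transps[l [k [[ul uk] [l4 k4] [ls ks] {1}->]]].
have [s [us hs]] := displaced_ex h.
set q := (_ %/ _)%N; have gq : (size (supp g) < q.+1 * size (supp h))%N.
  exact: (@ltn_ceil (size (supp g)) _ h0).
(* As 3 * size s >= size (supp h), the right-hand side is at least
   8 * (size (supp g)).+1 / 3. *)
have lq : (size (supp g) + 2 <= 4 * size s * (2 * q.+1))%N by nia.
have -> : (16 * q.+1 = 4 * (2 * q.+1) + 4 * (2 * q.+1))%N by lia.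
by apply: is_sym_productM; apply: (sym_product_transps us) => //; lia.
Qed.

(** * From finitary permutations to even ones *)

Lemma val_AinfV (p : Ainf) : val p^-1 = (val p)^-1.
Proof. by apply: (mulIg (val p)); rewrite -valM !mulVg. Qed.

Lemma val_AinfJ (p y : Ainf) : val (p ^ y) = val p ^ val y.
Proof. by rewrite !conjgE !valM val_AinfV. Qed.

(** If k is odd, it is replaced by (u v) k, where u and v are fixed by p, so that
    (u v) commutes with p. *)
Lemma Ainf_conj_lift (p : Ainf) (k : Sinf) :
  exists y : Ainf, val (p ^ y) = val p ^ k.
Proof.
have [s [sn kE]] := transp_generation k.
have [u pu _] := Sinf_fresh (val p) [::].
have [v pv] := Sinf_fresh (val p) [:: u]; rewrite inE => vu.
have [es|os] := boolP (odd (size s)); last first.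
  have /asboolP ek : even_Sinf k by exists s.
  by exists (exist _ k ek); rewrite val_AinfJ.
have /asboolP ek : even_Sinf (transp u v * k).
  exists ((u, v) :: s); split; rewrite /= ?es ?big_cons -?kE // => q.
  by rewrite inE => /predU1P[->|/sn //]; rewrite eq_sym.
exists (exist _ (transp u v * k) ek); rewrite val_AinfJ /= conjgM; congr (_ ^ _).
by rewrite conjgE transpV mulgA -{1}pu -{1}pv -mulg_transp -mulgA transp2 mulg1.
Qed.

Lemma Ainf_sym_product (h g : Ainf) n :
  is_sym_product h g n <-> is_sym_product (val h) (val g) n.
Proof.
split.
  move=> [s [sn hs ->]]; exists (map val s); split; rewrite ?size_map //.
    move=> _ /mapP[x /hs hx ->]; case: hx => -[y _ <-].
      by left; exists (val y); rewrite // val_AinfJ.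
    by right; exists (val y); rewrite // val_AinfJ val_AinfV.
  elim: s {sn hs} => [|x s IHs]; first by rewrite !big_nil val1.
  by rewrite map_cons !big_cons valM IHs.
move=> [s [<- hs]]; elim: s g hs => [|x s IHs] g hs.
  rewrite big_nil => g1; have -> : g = 1 by apply: val_inj; rewrite g1 val1.
  exact: is_sym_product0.
have [y [yx hy]] : exists y : Ainf, val y = x /\ sym_class h y.
  case: (hs x (mem_head _ _)) => -[k _ <-].
    by have [y yE] := Ainf_conj_lift h k; exists (h ^ y); split=> //; left; exists y.
  have [y yE] := Ainf_conj_lift h^-1 k; rewrite val_AinfV in yE.
  by exists (h^-1 ^ y); split=> //; right; exists y.
rewrite big_cons -yx => gE; rewrite -(mulKVg y g).
apply: (@is_sym_productM _ _ _ _ 1 (size s)); first exact/is_sym_product1.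
apply: IHs => [z zs|]; first by apply: hs; rewrite inE zs orbT.
by rewrite valM val_AinfV gE mulKg.
Qed.

(** * Support size as a coarse coordinate *)

Definition supp_card (g : Ainf) : nat := size (supp (val g)).

Lemma supp_card_gt0 g : g != 1 -> (0 < supp_card g)%N.
Proof.
move=> g1; apply: supp_gt0; apply: contra_neq g1 => g1.
by apply: val_inj; rewrite g1 val1.
Qed.

Lemma supp_card_sym_class h g : sym_class h g -> supp_card g = supp_card h.
Proof.
have le x y : sym_class x y -> (supp_card y <= supp_card x)%N.
  move=> /is_sym_product1 /Ainf_sym_product /size_supp_sym_product.
  by rewrite mul1n.
by move=> hg; apply/eqP; rewrite eqn_leq !le //; apply: sym_class_sym.
Qed.

Lemma supp_card_lambda h g : h != 1 ->
  (supp_card g <= lambda h g * supp_card h)%N.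
Proof.
by move=> /(lambdaP g)[/Ainf_sym_product /size_supp_sym_product].
Qed.

Lemma lambda_supp_card h g : h != 1 ->
  (lambda h g * supp_card h <= 16 * (supp_card g + supp_card h))%N.
Proof.
move=> h1; have [_ lam_min] := lambdaP g h1.
have vh1 : val h != 1.
  by apply: contra_neq h1 => h1; apply: val_inj; rewrite h1 val1.
have : (lambda h g <= 16 * (supp_card g %/ supp_card h).+1)%N.
  apply/lam_min/Ainf_sym_product/sym_product_even => //.
  exact: asboolW (valP g).
rewrite -(leq_pmul2r (supp_card_gt0 h1)) => /leq_trans; apply.
by have := leq_trunc_div (supp_card g) (supp_card h); lia.
Qed.

(** * Logarithmic estimates *)

Section LnEstimate.
Variable R : realType.
Local Open Scope ring_scope.

Lemma ler_ln_nat (m n : nat) : (0 < m)%N -> (m <= n)%N ->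
  ln (m%:R : R) <= ln (n%:R : R).
Proof.
by move=> m0 mn; rewrite ler_ln ?posrE ?ltr0n ?ler_nat // (leq_trans m0).
Qed.

Lemma ln_natM (m n : nat) : (0 < m)%N -> (0 < n)%N ->
  ln ((m * n)%N%:R : R) = ln (m%:R : R) + ln (n%:R : R).
Proof. by move=> m0 n0; rewrite natrM lnM ?posrE ?ltr0n. Qed.

(** The two bounds on m, which will be the larger of the two word lengths, say
    that m is the ratio of the larger to the smaller of a and b up to the factor
    c. *)
Lemma ln_ratio_estimate (a b m c : nat) :
  (0 < a)%N -> (0 < b)%N -> (0 < m)%N -> (0 < c)%N ->
  (a <= m * b)%N -> (b <= m * a)%N -> (m * minn a b <= c * maxn a b)%N ->
  ln (m%:R : R) - ln (c%:R : R) <=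
    `|ln (a%:R : R) - ln (b%:R : R)| <= ln (m%:R : R).
Proof.
wlog ab : a b / (b <= a)%N => [H|] a0 b0 m0 c0 amb bma mc.
  have [ba|/ltnW ab] := leqP b a; first exact: H.
  by rewrite distrC; apply: H; rewrite // minnC maxnC.
rewrite (minn_idPr ab) (maxn_idPl ab) in mc.
have lab := ler_ln_nat b0 ab; rewrite ger0_norm ?subr_ge0 //.
have := ler_ln_nat a0 amb; rewrite ln_natM // => lamb.
have := ler_ln_nat _ mc; rewrite !ln_natM // => /(_ _)/wrap[].
  by rewrite muln_gt0 m0.
by move=> lmc; apply/andP; split; lra.
Qed.

End LnEstimate.

(** Since 16 (n(g) + n(h)) is at most 32 times the larger support size, the two
    word-length bounds put the metric within ln 32 of the difference of the
    logarithms. *)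
Lemma hat_dist_supp_card (R : realType) (c d : hat R Ainf) :
  (hat_dist c d - ln 32 <=
    `|ln (supp_card (hat_repr c))%:R - ln (supp_card (hat_repr d))%:R|
  <= hat_dist c d)%R.
Proof.
have [c1 d1] := (hat_repr_neq1 c, hat_repr_neq1 d).
have [c0 d0] := (supp_card_gt0 c1, supp_card_gt0 d1).
rewrite /hat_dist; set m := maxn _ _.
have m0 : (0 < m)%N by rewrite leq_max lambda_gt0.
have cd := supp_card_lambda (hat_repr d) c1.
have dc := supp_card_lambda (hat_repr c) d1.
have := lambda_supp_card (hat_repr d) c1.
have := lambda_supp_card (hat_repr c) d1.
move=> dc' cd'; apply: ln_ratio_estimate => //.
- by apply: leq_trans dc _; rewrite leq_mul2r leq_maxr orbT.
- by apply: leq_trans cd _; rewrite leq_mul2r leq_maxl orbT.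
rewrite maxnMl geq_max; apply/andP; split.
  apply: leq_trans (leq_mul (leqnn _) (geq_minl _ _)) _.
  by apply: leq_trans cd' _; lia.
apply: leq_trans (leq_mul (leqnn _) (geq_minr _ _)) _.
by apply: leq_trans dc' _; lia.
Qed.

(** * Coarse density and conclusion *)

Lemma size_supp_transps (l : seq nat) : ~~ odd (size l) -> uniq l ->
  size (supp (transps l)) = size l.
Proof.
move=> el ul; apply/eqP; rewrite eqn_leq; apply/andP; split.
  apply: uniq_leq_size (supp_uniq _) _ => x; rewrite mem_supp.
  by apply: contraR => xl; rewrite transps_fix.
apply: uniq_leq_size => // x; rewrite mem_supp.
move: l el (el) ul x; apply: pair_seq_ind => // a b l IHl el2.
have {el2} el : ~~ odd (size l) by rewrite /= negbK in el2.
rewrite (@cat_uniq _ [:: a; b]) => /and3P[+ nl ul].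
rewrite cons_uniq inE andbT => ab.
have nab x : x \in [:: a; b] -> x \notin l.
  by move=> xs; apply: contraNN nl => xl; apply/hasP; exists x.
have [al bl] : a \notin l /\ b \notin l by rewrite !nab ?inE ?eqxx ?orbT.
have tE x : transps [:: a, b & l] x = transp a b (transps l x) by [].
move=> x; rewrite tE !inE => /or3P[/eqP->|/eqP->|xl].
- by rewrite transps_fix // transpL eq_sym.
- by rewrite transps_fix // transpR.
have fx c : c \notin l -> transps l x != c.
  move=> cl; apply/eqP => xc; suff xE : x = c by rewrite -xE xl in cl.
  by apply: (@Sinf_inj (transps l)); rewrite xc transps_fix.
by rewrite transpD; [exact: IHl|exact: fx|exact: fx].
Qed.

(** The product of 2 (n + 1) disjoint transpositions is even. *)
Lemma supp_card_ex n : exists2 g : Ainf, g != 1 & supp_card g = (4 * n.+1)%N.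
Proof.
have el : ~~ odd (size (iota 0 (4 * n.+1))) by rewrite size_iota; lia.
have [s [sn sl sE]] := transps_prod el (iota_uniq _ _).
rewrite size_iota in sl.
have /asboolP eg : even_Sinf (transps (iota 0 (4 * n.+1))).
  by exists s; split=> //; lia.
pose g : Ainf := exist _ (transps (iota 0 (4 * n.+1))) eg.
have gn : supp_card g = (4 * n.+1)%N.
  by rewrite /supp_card size_supp_transps ?iota_uniq // size_iota.
exists g => //; apply/eqP => g1.
have := size_supp_sym_product (is_sym_product0 (1 : Sinf)).
by move: gn; rewrite g1 /supp_card val1 => ->.
Qed.

Theorem theorem2 (R : realType) :
  quasi_isometric (hat R Ainf) (half_line R).
Proof.
have sc0 (c : hat R Ainf) : (0 < supp_card (hat_repr c))%N.
  exact/supp_card_gt0/hat_repr_neq1.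
have f_ge0 (c : hat R Ainf) : (0 <= ln ((supp_card (hat_repr c))%:R : R))%R.
  by rewrite ln_ge0 // ler1n.
pose f (c : hat R Ainf) : half_line R :=
  exist _ (ln ((supp_card (hat_repr c))%:R : R))%R (f_ge0 c).
exists f, 1%R, (ln 32), (ln 8); split=> //.
- by rewrite ln_ge0 // ler1n.
- by rewrite ln_ge0 // ler1n.
- move=> c d; rewrite invr1 !mul1r.
  have /andP[lo hi] := hat_dist_supp_card c d.
  have l32 : (0 <= ln (32 : R))%R by rewrite ln_ge0 // ler1n.
  apply/andP; split; first exact: lo.
  by apply: le_trans hi _; rewrite lerDl.
- move=> [y y0].
  (* With n the integer part of exp y, exp y < n + 1 <= 2 exp y, so
     4 (n + 1) lies between exp y and 8 exp y. *)
  have /andP[ny yn] := truncn_itv (expR_ge0 y).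
  set n := Num.truncn (expR y) in ny yn.
  have [g g1 gn] := supp_card_ex n; exists (hat_class R g1).
  have -> : mdist (f (hat_class R g1)) (exist _ y y0) =
      `|ln ((4 * n.+1)%N%:R : R) - y|%R.
    rewrite -gn; congr (`|ln (_%:R) - _|%R).
    apply: supp_card_sym_class.
    have := hat_reprK (hat_class R g1); rewrite /= => E.
    by rewrite -E; apply: sym_class_refl.
  have ey1 : (1 <= expR y)%R by rewrite -expR0 ler_expR.
  have yE : y = ln (expR y) by rewrite expRK.
  have N0 : (0 < (4 * n.+1)%N%:R :> R)%R by rewrite ltr0n.
  have lo : (y <= ln ((4 * n.+1)%N%:R : R))%R.
    rewrite {1}yE ler_ln ?posrE ?expR_gt0 //.
    by rewrite natrM; lra.
  have hi : (ln ((4 * n.+1)%N%:R : R) <= y + ln 8)%R.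
    rewrite {1}yE -lnM ?posrE ?expR_gt0 //.
    rewrite ler_ln ?posrE ?mulr_gt0 ?expR_gt0 //.
    by rewrite natrM -natr1; lra.
  by rewrite ger0_norm; lra.
Qed.
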